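(* Let $(\Omega,\mathcal{F},P)$ be a probability space with expectation $E$, and let $\{Z_i\}_{i=1}^\infty$ and $\{K_i\}_{i=1}^\infty$ be two i.i.d. sequences of real random variables on it, with the sequence $\{Z_i\}_{i=1}^\infty$ independent of the sequence $\{K_i\}_{i=1}^\infty$. Assume $E[|Z_1|^2]=\sigma^2>0$, $E[K_1]=0$, $E[|K_1|^2]=k^2>0$, and $E[|Z_1|^{2+2\alpha}]\vee E[|K_1|^{2+2\alpha}]<\infty$ for a given $\alpha\in(0,1]$. Let $\tilde{\mathcal{F}}_0:=\{\emptyset,\Omega\}$ and $\tilde{\mathcal{F}}_i:=\sigma(Z_1,\dots,Z_i,K_1,\dots,K_i)$ for $i\ge 1$. Let $0<\underline{\zeta}<\overline{\zeta}$ be constants and let $\tilde{\Sigma}[\underline{\zeta},\overline{\zeta}]$ be the collection of all sequences $\zeta=\{\zeta_i\}_{i=1}^\infty$ that are predictable with respect to $\{\tilde{\mathcal{F}}_i\}_{i\ge0}$ (i.e. $\zeta_i$ is $\tilde{\mathcal{F}}_{i-1}$-measurable for each $i\ge1$) and take values in $[\underline{\zeta},\overline{\zeta}]$. For $\zeta\in\tilde{\Sigma}[\underline{\zeta},\overline{\zeta}]$ and $n\in\mathbb{N}$, set $Z_i^\zeta:=(\zeta_iZ_i+K_i)^2$ and $W_{n,n}^\zeta:=\frac{Z_1^\zeta+\cdots+Z_n^\zeta}{n}$. Then for every Lipschitz continuous $\varphi:\mathbb{R}\to\mathbb{R}$ with Lipschitz constant $L_\varphi$ and every $n\in\mathbb{N}$,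 \[ \Bigg|\sup_{\zeta\in\tilde{\Sigma}[\underline{\zeta},\overline{\zeta}]}E[\varphi(W_{n,n}^\zeta)]-\max_{r\in[\sigma^2\underline{\zeta}^2+k^2,\ \sigma^2\overline{\zeta}^2+k^2]}\varphi(r)\Bigg|\leq L_\varphi\left(\frac{4\tilde{C}_\alpha}{n^\alpha}\right)^{\frac{1}{1+\alpha}}, \] where $\tilde{C}_\alpha:=\sup_{\zeta\in\tilde{\Sigma}[\underline{\zeta},\overline{\zeta}]} E[|Z_1^\zeta|^{1+\alpha}]$ satisfies $\tilde C_\alpha\leq 8\overline{\zeta}^{2+2\alpha} E[|Z_1|^{2+2\alpha}]+8E[|K_1|^{2+2\alpha}]<\infty$.
   Context: $a\vee b$ denotes $\max(a,b)$. A predictable sequence has $\zeta_1$ measurable with respect to the trivial $\sigma$-algebra, i.e. $\zeta_1$ is a constant in $[\underline\zeta,\overline\zeta]$. *)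

(* Defs.v *)
From HB Require Import structures.
From mathcomp Require Import all_boot all_order all_algebra.
From mathcomp Require Import all_classical all_reals all_analysis.
Set Implicit Arguments.
Unset Strict Implicit.
Unset Printing Implicit Defensive.
Import Order.TTheory GRing.Theory Num.Theory.
Import numFieldNormedType.Exports.
Local Open Scope classical_set_scope.
Local Open Scope ring_scope.

Section Defs.
Context {d : measure_display} {Omega : measurableType d} {R : realType}.

Definition preimages (f : Omega -> R) : set (set Omega) :=
  [set f @^-1` B | B in [set B : set R | measurable B]].

Definition gen_sigma (X : nat -> Omega -> R) (I : set nat) : set (set Omega) :=
  <<s \bigcup_(i in I) preimages (X i) >>.

(* sigma(Z_1,...,Z_j,K_1,...,K_j) with 0-based indices Z 0 = Z_1, ...;
   for j = 0 this is the trivial sigma-algebra {emptyset, Omega} *)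
Definition filtr (Z K : nat -> Omega -> R) (j : nat) : set (set Omega) :=
  <<s \bigcup_(i in [set i | (i < j)%N]) (preimages (Z i) `|` preimages (K i)) >>.

Definition measurable_wrt (G : set (set Omega)) (f : Omega -> R) : Prop :=
  forall B : set R, measurable B -> G (f @^-1` B).

Definition mutually_independent (P : probability Omega R) (X : nat -> Omega -> R)
  : Prop :=
  forall (J : seq nat) (B : nat -> set R), uniq J ->
    (forall i, measurable (B i)) ->
    P (\bigcap_(i in [set i | i \in J]) (X i @^-1` B i)) =
    (\prod_(i <- J) P (X i @^-1` B i))%E.

Definition identically_distributed (P : probability Omega R) (X : nat -> Omega -> R)
  : Prop :=
  forall i (B : set R), measurable B -> P (X i @^-1` B) = P (X 0%N @^-1` B).

Definition iid (P : probability Omega R) (X : nat -> Omega -> R) : Prop :=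
  (forall i, measurable_fun setT (X i)) /\
  mutually_independent P X /\ identically_distributed P X.

Definition indep_seqs (P : probability Omega R) (X Y : nat -> Omega -> R) : Prop :=
  forall A B, gen_sigma X setT A -> gen_sigma Y setT B ->
    P (A `&` B) = (P A * P B)%E.

(* \tilde\Sigma[lo, hi]: predictable sequences with values in [lo, hi];
   zeta j (0-based) plays the role of zeta_{j+1} and must be
   sigma(Z_1..Z_j, K_1..K_j)-measurable *)
Definition Sigma_tilde (Z K : nat -> Omega -> R) (lo hi : R)
  : set (nat -> Omega -> R) :=
  [set zeta | (forall j, measurable_wrt (filtr Z K j) (zeta j)) /\
              (forall j x, lo <= zeta j x <= hi)].

Definition W (Z K zeta : nat -> Omega -> R) (n : nat) (x : Omega) : R :=
  (\sum_(i < n) (zeta i x * Z i x + K i x) ^+ 2) / n%:R.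

End Defs.

(* Main.v *)
(* Write p = 1 + alpha and m(z) = sigma2 z^2 + k2, the mean of
   X^z = (z Z_1 + K_1)^2, and let S_n be the sum of X_i - m(zeta_i), where
   X_i = (zeta_i Z_i + K_i)^2, so that W = S_n / n + (average of the m(zeta_i)).
   Since zeta_i is independent of (Z_i, K_i), the latter can be integrated out
   with the past frozen; the elementary bound
     |s + d|^p <= |s|^p + p sgn(s) |s|^alpha d + 2 |d|^p,
   whose linear term has mean zero, together with
     E|X^z - m(z)|^p <= E|X^z|^p + m(z)^p <= 2 C
   then gives E|S_n|^p <= 4 C n, hence
   E|S_n| / n <= (4 C n)^(1/p) / n = (4 C / n^alpha)^(1/p).
   The average of the m(zeta_i) always lies in the interval over which phi is
   maximised, and equals any prescribed point r of it when zeta is the constant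
   sqrt((r - k2) / sigma2). *)
Require Import Defs.
From HB Require Import structures.
From mathcomp Require Import all_boot all_order all_algebra.
From mathcomp Require Import all_classical all_reals all_analysis.
From mathcomp Require Import measurable_realfun ring lra.
Import Order.TTheory GRing.Theory Num.Theory.
Import numFieldNormedType.Exports.
Local Open Scope classical_set_scope.
Local Open Scope ring_scope.
Set Implicit Arguments.
Unset Strict Implicit.
Unset Printing Implicit Defensive.

(** * Elementary inequalities for real powers *)

(** Young's inequality for the product of t^a and 1, with conjugate exponents 1/a and 1/(1 - a);
    these degenerate at a = 1, which is treated apart. *)
Lemma powR_le_affine {R : realType} (a t : R) :
  0 < a <= 1 -> 0 <= t -> t `^ a <= 1 + a * (t - 1).
Proof.
move=> /andP[a0]; rewrite le_eqVlt => /predU1P[->|a1] t0.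
  by rewrite powRr1//; lra.
have := @conjugate_powR R (t `^ a) 1 a^-1 (1 - a)^-1.
rewrite powR_ge0 ler01 !invr_gt0 a0 subr_gt0 a1 !invrK => /(_ isT isT isT isT).
rewrite -powRrM mulfV ?gt_eqF// powRr1// powR1 mulr1 => H.
have /H : a + (1 - a) = 1 by ring.
by lra.
Qed.

Lemma powR_1Dx_le {R : realType} (a x : R) :
  0 < a <= 1 -> -1 <= x -> (1 + x) `^ a <= 1 + a * x.
Proof.
move=> a01 x1; have : 0 <= 1 + x by lra.
by move=> /(powR_le_affine a01); rewrite addrAC subrr add0r.
Qed.

(** The concave bound at exponent 1/p and argument t^p, solved for t^p. *)
Lemma powR_ge_affine {R : realType} (p t : R) :
  1 <= p -> 0 <= t -> 1 + p * (t - 1) <= t `^ p.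
Proof.
move=> p1 t0.
have p0 : 0 < p by lra.
have := @powR_le_affine R p^-1 (t `^ p).
rewrite invr_gt0 p0 invf_le1// p1 powR_ge0 => /(_ isT isT).
rewrite -powRrM mulfV ?gt_eqF// powRr1// => H.
have : p * t <= p * (1 + p^-1 * (t `^ p - 1)) by rewrite ler_pM2l.
by rewrite mulrDr mulrA mulfV ?gt_eqF// mul1r; lra.
Qed.

Lemma powRD1 {R : realType} (a x : R) :
  0 < a -> 0 <= x -> x `^ (1 + a) = x * x `^ a.
Proof.
by move=> a0 x0; rewrite -(@mulr_powRB1 _ x (1 + a))// ?addrK//; [congr (_ * _ `^ _); ring|lra].
Qed.

(** Homogeneity moves the point of tangency from x to 1, where the affine bound applies; x = 0 is
    apart because y / x is used. *)
Lemma powR_ge_tangent {R : realType} (a x y : R) :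
  0 < a -> 0 <= x -> 0 <= y ->
  x `^ (1 + a) + (1 + a) * x `^ a * (y - x) <= y `^ (1 + a).
Proof.
move=> a0; rewrite le_eqVlt => /predU1P[<-|x0] y0.
  by rewrite !powR0 ?gt_eqF ?addr_gt0// mulr0 mul0r addr0 powR_ge0.
have -> : y = x * (y / x) by rewrite mulrC divfK// gt_eqF.
have t0 : 0 <= y / x by rewrite divr_ge0// ltW.
rewrite powRM ?(ltW x0)//; set t := y / x in t0 *.
have -> : x `^ (1 + a) + (1 + a) * x `^ a * (x * t - x)
    = x `^ (1 + a) * (1 + (1 + a) * (t - 1)).
  by rewrite powRD1 ?ltW//; ring.
rewrite ler_wpM2l ?powR_ge0//.
by apply: powR_ge_affine => //; lra.
Qed.

Lemma powR_le_id {R : realType} (a t : R) :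
  0 < a -> 1 <= t -> t `^ a <= t `^ (1 + a).
Proof. by move=> a0 t1; rewrite ler_powR//; lra. Qed.

(** Case s = 1 of the elementary bound. For |t| <= 1 the affine bound on (1 + t)^a leaves the excess
    a t^2, at most |t|^(1 + a); for |t| > 1 the term 2 |t|^(1 + a) dominates. *)
Lemma powR_1Dx_upper {R : realType} (a t : R) : 0 < a <= 1 -> 
  `|1 + t| `^ (1 + a) <= 1 + (1 + a) * t + 2 * `|t| `^ (1 + a).
Proof.
move=> a01; have /andP[a0 a1] := a01.
have sq u : 0 <= u -> u <= 1 -> u ^+ 2 <= u `^ (1 + a).
  move=> u0 u1; have [->|un0] := eqVneq u 0.
    by rewrite expr0n powR_ge0.
  rewrite -powR_mulrn//; apply: ger_powR; last by lra.
  by rewrite u1 lt_neqAle eq_sym un0 u0.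
have asq u : 0 <= u -> u <= 1 -> a * u ^+ 2 <= u `^ (1 + a).
  move=> u0 u1; apply: le_trans (sq _ u0 u1).
  by rewrite ler_piMl// sqr_ge0.
have [t0|t0] := leP 0 t.
  rewrite !ger0_norm//; last by lra.
  have pt : 0 <= t `^ (1 + a) by exact: powR_ge0.
  have [t1|t1] := leP t 1.
    rewrite powRD1//; last by lra.
    have h : (1 + t) `^ a <= 1 + a * t by apply: powR_1Dx_le => //; lra.
    have : (1 + t) * (1 + t) `^ a <= (1 + t) * (1 + a * t).
      by rewrite ler_pM2l//; lra.
    have := asq _ t0 t1; lra.
  (* Taking t out of 1 + t, the affine bound in 1/t gives t^a + a t^(a - 1), and t^(a - 1) <= 1. *)
  have h : (1 + t) `^ a <= t `^ a + a.
    have tn0 : t != 0 by rewrite gt_eqF//; lra.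
    have -> : 1 + t = t * (1 + t^-1) by field.
    rewrite powRM ?addr_ge0 ?invr_ge0//.
    have h1 : (1 + t^-1) `^ a <= 1 + a * t^-1.
      apply: powR_1Dx_le => //.
      by apply: (@le_trans _ _ 0); rewrite ?invr_ge0// lerN10.
    apply: (le_trans (ler_wpM2l (powR_ge0 _ _) h1)).
    rewrite mulrDr mulr1 lerD2l mulrCA; apply: ler_piMr; first exact: ltW.
    by rewrite ler_pdivrMr ?mul1r; [apply: ler1_powR => //; exact: ltW|lra].
  have ta := powR_le_id a0 (ltW t1).
  rewrite powRD1; [|lra..].
  have : (1 + t) * (1 + t) `^ a <= (1 + t) * (t `^ a + a).
    by rewrite ler_pM2l//; lra.
  have := powRD1 a0 t0; nra.
have [u u0 ->] : exists2 u, 0 < u & t = - u by exists (- t); rewrite ?oppr_gt0 ?opprK.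
rewrite normrN (ger0_norm (ltW u0)).
have pu : 0 <= u `^ (1 + a) by exact: powR_ge0.
have [u1|u1] := leP u 1.
  rewrite ger0_norm; last by lra.
  rewrite powRD1//; last by lra.
  have h : (1 - u) `^ a <= 1 - a * u.
    by rewrite -mulrN; apply: powR_1Dx_le => //; lra.
  have : (1 - u) * (1 - u) `^ a <= (1 - u) * (1 - a * u).
    by rewrite ler_wpM2l//; lra.
  have := asq _ (ltW u0) u1; lra.
rewrite ler0_norm; last by lra.
(* One of the two copies of u^(1 + a) absorbs |1 - u|^(1 + a); the other, by its tangent at 1,
   outweighs the negative linear term. *)
have h1 : (- (1 - u)) `^ (1 + a) <= u `^ (1 + a).
  by apply: ge0_ler_powR; rewrite ?nnegrE; lra.
have p1 : 1 <= 1 + a by lra.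
have := powR_ge_affine p1 (ltW u0); lra.
Qed.

(** Scaling by s reduces to the previous case; at s = 0 the linear term vanishes and only |d|^(1 +
    a) is left to compare. *)
Lemma powR_normD_upper {R : realType} (a s d : R) : 0 < a <= 1 ->
  `|s + d| `^ (1 + a) <=
  `|s| `^ (1 + a) + (1 + a) * Num.sg s * `|s| `^ a * d + 2 * `|d| `^ (1 + a).
Proof.
move=> a01; have /andP[a0 a1] := a01.
have [->|s0] := eqVneq s 0.
  rewrite add0r normr0 sgr0 !powR0 ?gt_eqF ?addr_gt0// mulr0 !mul0r !add0r.
  by rewrite ler_peMl ?powR_ge0// ler1n.
have -> : d = s * (d / s) by rewrite mulrC divfK.
move: (d / s) => t {d}.
have -> : s + s * t = s * (1 + t) by ring.
rewrite !normrM !powRM//.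
have -> : (1 + a) * Num.sg s * `|s| `^ a * (s * t) = `|s| `^ (1 + a) * ((1 + a) * t).
  by rewrite powRD1// {2}[`|s|]normrEsg; ring.
have := powR_1Dx_upper t a01.
rewrite -(@ler_pM2l _ (`|s| `^ (1 + a))) ?powR_gt0 ?normr_gt0//.
by rewrite !mulrDr mulr1 [X in _ <= _ + X -> _]mulrCA.
Qed.

(** The difference of two nonnegative numbers is at most the larger in absolute value, so no factor
    2^(p - 1) appears. *)
Lemma powR_normB_le {R : realType} (p x y : R) : 0 <= p -> 0 <= x -> 0 <= y ->
  `|x - y| `^ p <= x `^ p + y `^ p.
Proof.
move=> p0 x0 y0; have [xy|xy] := leP x y.
  apply: (@le_trans _ _ (y `^ p)); last by rewrite lerDr powR_ge0.
  by apply: ge0_ler_powR; rewrite ?nnegrE// ler0_norm; lra.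
apply: (@le_trans _ _ (x `^ p)); last by rewrite lerDl powR_ge0.
by apply: ge0_ler_powR; rewrite ?nnegrE// ger0_norm; lra.
Qed.

(** Convexity at the midpoint m of |x| and |y| gives 2 m^q <= |x|^q + |y|^q, and (2 m)^q <= 2^4 m^q
    because q <= 4; hence the factor 2^4 / 2 = 8. *)
Lemma powR_normD_le8 {R : realType} (q x y : R) : 1 < q <= 4 ->
  `|x + y| `^ q <= 8 * (`|x| `^ q + `|y| `^ q).
Proof.
move=> /andP[q1 q4]; set m := (`|x| + `|y|) / 2.
have q0 : 0 <= q by lra.
have b0 : 0 < q - 1 by lra.
have m0 : 0 <= m by rewrite divr_ge0// addr_ge0.
have tx := powR_ge_tangent b0 m0 (normr_ge0 x).
have ty := powR_ge_tangent b0 m0 (normr_ge0 y).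
rewrite addrCA subrr addr0 in tx ty.
have mx : 2 * m `^ q <= `|x| `^ q + `|y| `^ q.
  (* The linear terms of the two tangent bounds are opposite. *)
  have : q * m `^ (q - 1) * (`|x| - m) = - (q * m `^ (q - 1) * (`|y| - m)).
    have -> : `|y| - m = - (`|x| - m) by rewrite /m; field.
    by rewrite mulrN opprK.
  by lra.
apply: (@le_trans _ _ ((2 * m) `^ q)).
  apply: ge0_ler_powR; rewrite ?nnegrE ?mulr_ge0//.
  by rewrite /m mulrC divfK// ler_normD.
rewrite powRM//.
apply: (@le_trans _ _ (2 ^+ 4 * m `^ q)); last by lra.
by rewrite ler_wpM2r ?powR_ge0// -powR_mulrn// ler_powR// ler1n.
Qed.

(** * Independence and product laws *)

Section Independence.
Context {d : measure_display} {Omega : measurableType d} {R : realType}.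
Variable P : probability Omega R.

(* [Y'] has the law of [Y], so [Y] may be integrated out with [X] frozen. *)
Lemma ge0_integral_indep d1 d2 (T1 : measurableType d1) (T2 : measurableType d2)
  (X : Omega -> T1) (Y Y' : Omega -> T2) (f : T1 * T2 -> \bar R) :
  measurable_fun setT X -> measurable_fun setT Y -> measurable_fun setT Y' ->
  (forall A B, measurable A -> measurable B ->
    P (X @^-1` A `&` Y @^-1` B) = (P (X @^-1` A) * P (Y' @^-1` B))%E) ->
  measurable_fun [set: T1 * T2] f -> (forall z, 0 <= f z)%E ->
  (\int[P]_x f (X x, Y x) = \int[P]_x \int[P]_y f (X x, Y' y))%E.
Proof.
move=> mX mY mY' XY mf f0.
have mXY : measurable_fun setT (fun x => (X x, Y x)) by exact: measurable_fun_pair.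
pose X_ : {mfun Omega >-> T1} := HB.pack X (isMeasurableFun.Build _ _ _ _ _ mX).
pose Y_ : {mfun Omega >-> T2} := HB.pack Y' (isMeasurableFun.Build _ _ _ _ _ mY').
pose XY_ : {mfun Omega >-> (T1 * T2)%type} :=
  HB.pack (fun x => (X x, Y x)) (isMeasurableFun.Build _ _ _ _ _ mXY).
(* By independence the joint law is the product law on rectangles, hence everywhere. *)
have E C : measurable C -> (distribution P X_ \x distribution P Y_)%E C = distribution P XY_ C.
  apply: product_measure_unique => A B mA mB.
  by rewrite /distribution /pushforward /= -XY.
transitivity (\int[distribution P XY_]_z f z)%E.
  by rewrite ge0_integral_distribution.
transitivity (\int[(distribution P X_ \x distribution P Y_)]_z f z)%E.
  by apply: eq_measure_integral => C mC _; apply: esym; exact: E.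
rewrite fubini_tonelli1// /fubini_F ge0_integral_distribution//; last 2 first.
- exact: measurable_fun_fubini_tonelli_F.
- by move=> x; exact: integral_ge0.
apply: eq_integral => x _ /=; rewrite ge0_integral_distribution//.
exact: (measurableT_comp mf (pair1_measurable _)).
Qed.

End Independence.

(** Uniqueness of measures on a pi-system; since it contains the whole space, the constant sequence
    [setT] is an exhaustion of finite mass. *)
Lemma finite_measure_unique_pi d (T : measurableType d) (R : realType)
  (G : set (set T)) (m1 m2 : {measure set T -> \bar R}) :
  G `<=` measurable -> setI_closed G -> G setT -> (m1 setT < +oo)%E ->
  (forall A, G A -> m1 A = m2 A) -> forall A, <<s G >> A -> m1 A = m2 A.
Proof.
move=> Gm GI GT m1T m12.
apply: (@g_sigma_algebra_measure_unique _ _ _ G Gm (fun=> setT)) => //.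
by rewrite bigcup_const//; exists 0%N.
Qed.

(** * Independence of the current pair from the past *)

Section Filtration.
Context {d : measure_display} {Omega : measurableType d} {R : realType}.
Variables (P : probability Omega R) (Z K : nat -> Omega -> R).
Hypotheses (iidZ : iid P Z) (iidK : iid P K) (ZK : indep_seqs P Z K).

(** [B] is indexed by all of [nat], so that adding a condition at time [n] is an update of [B]. *)
Definition past (X : nat -> Omega -> R) (n : nat) (B : nat -> set R) : set Omega :=
  \bigcap_(i in [set i | (i < n)%N]) (X i @^-1` B i).

Lemma iid_preimage X i D : iid P X -> measurable D -> measurable (X i @^-1` D).
Proof. by move=> [mX _] mD; rewrite -[_ @^-1` _]setTI; exact: mX. Qed.

(** Transfers measurability to the type [g_sigma_algebraType G], where the closure properties of
    [measurable_fun] apply to the filtration. *)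
Lemma measurable_wrt_fun (G : set (set Omega)) (X : Omega -> R) :
  measurable_wrt <<s G >> X <->
  measurable_fun setT (X : g_sigma_algebraType G -> R).
Proof.
split => [mX _ B mB|mX B mB]; first by rewrite setTI; exact: mX.
by rewrite -[_ @^-1` _]setTI; exact: mX.
Qed.

Lemma measurable_past (G : set (set Omega)) X n B :
  (forall i, (i < n)%N -> measurable_wrt <<s G >> (X i)) ->
  (forall i, measurable (B i)) -> <<s G >> (past X n B).
Proof.
move=> mX mB.
apply: (@fin_bigcap_measurable _ (g_sigma_algebraType G)).
  exact: finite_II.
by move=> i ni; exact: mX.
Qed.

Lemma past_recr X n B D : past X n B `&` X n @^-1` D =
  past X n.+1 (fun i => if i == n then D else B i).
Proof.
rewrite eqEsubset; split => x.
  move=> [xB xD] i /=; rewrite ltnS leq_eqVlt.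
  by case: eqVneq => [->//|_ /= ni]; exact: xB.
move=> xC; split.
  by move=> i /= ni; have /= := xC i (ltnW ni); rewrite ltn_eqF.
by have /= := xC n (ltnSn n); rewrite eqxx.
Qed.

Lemma mutually_independent_past X n B : mutually_independent P X ->
  (forall i, measurable (B i)) ->
  P (past X n B) = (\prod_(0 <= i < n) P (X i @^-1` B i))%E.
Proof.
move=> XI mB; have := XI (iota 0 n) B (iota_uniq _ _) mB.
rewrite /index_iota subn0 => <-; congr (P _); rewrite /past; congr bigcap.
by apply/seteqP; split => i /=; rewrite mem_iota.
Qed.

Lemma mutually_independent_recr X n B D : mutually_independent P X ->
  (forall i, measurable (B i)) -> measurable D ->
  P (past X n B `&` X n @^-1` D) = (P (past X n B) * P (X n @^-1` D))%E.
Proof.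
move=> XI mB mD; rewrite past_recr !mutually_independent_past//; last first.
  by move=> i; case: ifP.
rewrite big_nat_recr//= eqxx; congr (_ * _)%E.
by apply: eq_big_nat => i /andP[_ ni]; rewrite ltn_eqF.
Qed.

(** The preimages that define [filtr] are not stable under intersection; their finite intersections,
    the cylinders, form a pi-system. *)
Definition cylinders n : set (set Omega) :=
  [set A | exists BZ BK : nat -> set R,
    [/\ forall i, measurable (BZ i), forall i, measurable (BK i) &
        A = past Z n BZ `&` past K n BK]].

(** Each generator is a cylinder with [setT] as every other condition. *)
Lemma filtr_cylinders n : filtr Z K n `<=` <<s cylinders n >>.
Proof.
have pT X (B : nat -> set R) : (forall i, B i = setT) -> past X n B = setT.
  by move=> BT; rewrite -subTset => x _ i _ /=; rewrite BT.
have p1 X i D : (i < n)%N ->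
    past X n (fun j => if j == i then D else setT) = X i @^-1` D.
  move=> ni; apply/seteqP; split => x.
    by move=> /(_ i ni)/=; rewrite eqxx.
  by move=> xD j _ /=; case: eqVneq => // ->.
apply: smallest_sub; first exact: smallest_sigma_algebra.
move=> A [i /= ni] iA; apply: sub_sigma_algebra.
case: iA => -[D mD <-].
  exists (fun j => if j == i then D else setT), (fun=> setT).
  by split => //; [move=> j; case: ifP|rewrite p1// pT// setIT].
exists (fun=> setT), (fun j => if j == i then D else setT).
by split => //; [move=> j; case: ifP|rewrite p1// pT// setTI].
Qed.

Lemma filtr_measurable n : filtr Z K n `<=` measurable.
Proof.
apply: smallest_sub; first exact: sigma_algebra_measurable.
by move=> A [i _ [[D mD <-]|[D mD <-]]]; exact: iid_preimage.
Qed.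

Lemma filtr_mono m n : (m <= n)%N -> filtr Z K m `<=` filtr Z K n.
Proof.
move=> mn; apply: sub_sigma_algebra2.
by apply: bigcup_subset => i /= /leq_trans; apply.
Qed.

(** Regrouping gives one event in the Z and one in the K, which [indep_seqs] separates; independence
    within each sequence splits off time [n], and equality in law returns to index 0. *)
Lemma cylinders_indep n A D E : cylinders n A -> measurable D -> measurable E ->
  P (A `&` (Z n @^-1` D `&` K n @^-1` E)) =
  (P A * (P (Z 0%N @^-1` D) * P (K 0%N @^-1` E)))%E.
Proof.
have [mZ [indZ idZ]] := iidZ; have [mK [indK idK]] := iidK.
move=> [BZ [BK [mBZ mBK ->]]] mD mE.
have mw X i : measurable_wrt (gen_sigma X setT) (X i).
  by move=> B mB; apply: sub_sigma_algebra; exists i => //; exists B.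
have past_sig X m B : (forall i, measurable (B i)) -> gen_sigma X setT (past X m B).
  by move=> mB; apply: measurable_past => // i _; exact: mw.
rewrite setIACA ZK.
- rewrite (ZK (past_sig Z n _ mBZ) (past_sig K n _ mBK)).
  by rewrite !mutually_independent_recr// (idZ n D)// (idK n E)// muleACA.
- by rewrite past_recr; apply: past_sig => i; case: ifP.
- by rewrite past_recr; apply: past_sig => i; case: ifP.
Qed.

Lemma cylinders_setI n : setI_closed (cylinders n).
Proof.
move=> _ _ [BZ [BK [mBZ mBK ->]]] [BZ' [BK' [mBZ' mBK' ->]]].
exists (fun i => BZ i `&` BZ' i), (fun i => BK i `&` BK' i).
split; [by move=> i; exact: measurableI..|].
by rewrite setIACA /past -!bigcapI.
Qed.

Lemma cylinders_setT n : cylinders n setT.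
Proof.
exists (fun=> setT), (fun=> setT); split => //.
by apply/esym; rewrite -subTset => x _; split.
Qed.

Lemma measurable_past_borel X n B : iid P X ->
  (forall i, measurable (B i)) -> measurable (past X n B).
Proof.
move=> iidX mB; apply: fin_bigcap_measurable; first exact: finite_II.
by move=> i _; exact: iid_preimage.
Qed.

Lemma cylinders_measurable n : cylinders n `<=` measurable.
Proof.
by move=> _ [BZ [BK [mBZ mBK ->]]]; apply: measurableI; exact: measurable_past_borel.
Qed.

(** Both sides are finite measures in A, the restriction of P to the event at time n and a multiple
    of P, and they agree on the cylinders. *)
Lemma filtr_indep_rect n A D E : filtr Z K n A -> measurable D -> measurable E ->
  P (A `&` (Z n @^-1` D `&` K n @^-1` E)) =
  (P A * (P (Z 0%N @^-1` D) * P (K 0%N @^-1` E)))%E.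
Proof.
move=> nA mD mE.
have mDE : measurable (Z n @^-1` D `&` K n @^-1` E).
  by apply: measurableI; exact: iid_preimage.
set c := (P (Z 0%N @^-1` D) * P (K 0%N @^-1` E))%E.
have c0 : (0 <= c)%E by rewrite mule_ge0.
have cfin : c \is a fin_num by rewrite fin_numM// fin_num_measure//; exact: iid_preimage.
(* [mscale] takes a nonnegative real, so the extended real [c] is first turned into one. *)
pose c' : {nonneg R} := NngNum (fine_ge0 c0).
have c'E : (c'%:num)%:E = c by rewrite /= fineK.
rewrite muleC -c'E -[RHS]/(mscale c' P A) -[LHS]/(mrestr P mDE A).
apply: (@finite_measure_unique_pi _ _ _ (cylinders n)).
- exact: cylinders_measurable.
- exact: cylinders_setI.
- exact: cylinders_setT.
- by rewrite /= /mrestr setTI -ge0_fin_numE// fin_num_measure.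
- move=> B nB /=; rewrite /mrestr /mscale c'E muleC.
  exact: cylinders_indep.
- exact: filtr_cylinders.
Qed.

(** Now A is fixed and both sides are finite measures in C on the plane; rectangles are a pi-system
    that generates the product sigma-algebra. *)
Lemma filtr_indep n A C : filtr Z K n A -> measurable C ->
  P (A `&` (fun x => (Z n x, K n x)) @^-1` C) =
  (P A * P ((fun x => (Z 0%N x, K 0%N x)) @^-1` C))%E.
Proof.
move=> nA mC.
have mA := filtr_measurable nA.
have [mZ _] := iidZ; have [mK _] := iidK.
have mZK i : measurable_fun setT (fun x => (Z i x, K i x)).
  exact: measurable_fun_pair.
have PAfin : P A \is a fin_num by rewrite fin_num_measure.
pose c : {nonneg R} := NngNum (fine_ge0 (measure_ge0 P A)).
have cE : (c%:num)%:E = P A by rewrite /= fineK.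
(* [m1] is the image under the pair at time n of P restricted to A; [m2] is P(A) times the law of
   the first pair. *)
pose m1 : {measure set (R * R) -> \bar R} :=
  measure_function_pushforward__canonical__measure_function_Measure
    (mrestr P mA) (mZK n).
pose m2 : {measure set (R * R) -> \bar R} :=
  mscale c (measure_function_pushforward__canonical__measure_function_Measure
    P (mZK 0%N)).
suff : m1 C = m2 C by rewrite setIC -cE.
pose G := [set B `*` B' | B in @measurable _ R & B' in @measurable _ R].
apply: (@finite_measure_unique_pi _ _ _ G).
- by move=> _ [B mB [B' mB' <-]]; exact: measurableX.
- move=> _ _ [B mB [B' mB' <-]] [D mD [D' mD' <-]].
  exists (B `&` D); first exact: measurableI.
  by exists (B' `&` D'); [exact: measurableI|rewrite setXI].
- by exists setT => //; exists setT => //; rewrite setXTT.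
- rewrite /= /pushforward /mrestr preimage_setT setTI.
  by rewrite -ge0_fin_numE.
- move=> _ [B mB [B' mB' <-]] /=.
  rewrite /mscale /pushforward /mrestr cE setIC.
  rewrite [X in P (_ `&` X)](_ : _ = Z n @^-1` B `&` K n @^-1` B')//.
  rewrite [X in (_ * P X)%E](_ : _ = Z 0%N @^-1` B `&` K 0%N @^-1` B')//.
  rewrite filtr_indep_rect//; congr (_ * _)%E.
  (* At time 0, with the whole space as A, the rectangle formula gives the law of the first pair on
     rectangles. *)
  have := @filtr_indep_rect 0%N setT B B'; rewrite setTI probability_setT mul1e => -> //.
  exact: (@measurableT _ (g_sigma_algebraType _)).
- by rewrite -measurable_prod_measurableType.
Qed.

(** [X] carries what is known before the pair at time [n], so that the pair may be replaced by a
    fresh copy of the first one. *)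
Lemma ge0_integral_filtr d' (T : measurableType d') n (X : Omega -> T)
  (f : T * (R * R) -> \bar R) :
  (forall A, measurable A -> filtr Z K n (X @^-1` A)) ->
  measurable_fun [set: T * (R * R)] f -> (forall z, 0 <= f z)%E ->
  (\int[P]_x f (X x, (Z n x, K n x)) =
   \int[P]_x \int[P]_y f (X x, (Z 0%N y, K 0%N y)))%E.
Proof.
move=> mX mf f0; have [mZ _] := iidZ; have [mK _] := iidK.
apply: (@ge0_integral_indep _ _ _ P _ _ _ _ X (fun x => (Z n x, K n x))
  (fun x => (Z 0%N x, K 0%N x)) f) => //.
- by move=> _ A mA; rewrite setTI; apply: filtr_measurable; exact: mX.
- exact: measurable_fun_pair.
- exact: measurable_fun_pair.
- by move=> A B mA mB; exact: filtr_indep (mX _ mA) mB.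
Qed.

(** Independence of the first Z and the first K is the rectangle formula at time 0 with the whole
    space as A. *)
Lemma ge0_integral_ZK (f : R * R -> \bar R) :
  measurable_fun [set: R * R] f -> (forall z, 0 <= f z)%E ->
  (\int[P]_x f (Z 0%N x, K 0%N x) =
   \int[P]_x \int[P]_y f (Z 0%N x, K 0%N y))%E.
Proof.
move=> mf f0; have [mZ _] := iidZ; have [mK _] := iidK.
apply: ge0_integral_indep => // A B mA mB.
have := @filtr_indep_rect 0%N setT A B; rewrite setTI probability_setT mul1e => -> //.
exact: (@measurableT _ (g_sigma_algebraType _)).
Qed.

End Filtration.

(** * Moment inequalities under a probability *)

Section Moments.
Context {d : measure_display} {Omega : measurableType d} {R : realType}.
Variable P : probability Omega R.

Lemma integral_prob_cst (c : R) : (\int[P]_x c%:E = c%:E)%E.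
Proof. by rewrite integral_cst// [X in (_ * X)%E]probability_setT mule1. Qed.

Lemma integrable_ge0 (X : Omega -> R) (c : R) : measurable_fun setT X ->
  (forall x, 0 <= X x) -> (\int[P]_x (X x)%:E <= c%:E)%E ->
  P.-integrable setT (EFin \o X).
Proof.
move=> mX X0 Xc; apply/integrableP; split; first exact/measurable_EFinP.
under eq_integral do rewrite /= ger0_norm//.
exact: le_lt_trans Xc (ltry _).
Qed.

(** Two variables cover all uses; a single variable is passed twice, with [c = 0]. *)
Lemma integrable_affine (X Y : Omega -> R) (a b c : R) :
  P.-integrable setT (EFin \o X) -> P.-integrable setT (EFin \o Y) ->
  P.-integrable setT (EFin \o (fun x => a + b * X x + c * Y x)).
Proof.
move=> iX iY.
have ia : P.-integrable setT (fun x => a%:E)%E by exact: finite_measure_integrable_cst.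
have ibX : P.-integrable setT (fun x => b%:E * (X x)%:E)%E by exact: integrableZl.
have icY : P.-integrable setT (fun x => c%:E * (Y x)%:E)%E by exact: integrableZl.
exact: integrableD (integrableD _ ia ibX) icY.
Qed.

Lemma integral_affine (X Y : Omega -> R) (a b c mX mY : R) :
  P.-integrable setT (EFin \o X) -> P.-integrable setT (EFin \o Y) ->
  (\int[P]_x (X x)%:E = mX%:E)%E -> (\int[P]_x (Y x)%:E = mY%:E)%E ->
  (\int[P]_x (a + b * X x + c * Y x)%:E = (a + b * mX + c * mY)%:E)%E.
Proof.
move=> iX iY EX EY.
have ia : P.-integrable setT (fun x => a%:E)%E by exact: finite_measure_integrable_cst.
have ibX : P.-integrable setT (fun x => b%:E * (X x)%:E)%E by exact: integrableZl.
have icY : P.-integrable setT (fun x => c%:E * (Y x)%:E)%E by exact: integrableZl.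
under eq_integral do rewrite 2!EFinD 2!EFinM.
rewrite integralD//; last exact: integrableD.
rewrite integralD// !integralZl// EX EY integral_prob_cst.
by rewrite 2!EFinD 2!EFinM.
Qed.

(** When the square is expanded, the cross term 2 c X has mean zero. *)
Lemma integral_sqr_shift (X : Omega -> R) (c v : R) :
  measurable_fun setT X -> (\int[P]_x (X x)%:E = 0)%E ->
  (\int[P]_x (`|X x| ^+ 2)%:E = v%:E)%E ->
  (\int[P]_x ((c + X x) ^+ 2)%:E = (c ^+ 2 + v)%:E)%E.
Proof.
move=> mX EX EX2.
have iX2 : P.-integrable setT (EFin \o (fun x => `|X x| ^+ 2)).
  apply: (@integrable_ge0 _ v); rewrite ?EX2//.
  by apply: measurable_funX; exact: measurableT_comp.
(* X is integrable because |x| <= 1 + |x|^2. *)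
have iX : P.-integrable setT (EFin \o X).
  apply: (@le_integrable _ _ _ P setT _ _ (EFin \o (fun x => 1 + `|X x| ^+ 2))) => //.
  - exact/measurable_EFinP.
  - move=> x _ /=; rewrite lee_fin.
    rewrite [leRHS]ger0_norm ?addr_ge0 ?sqr_ge0//.
    have := normr_ge0 (X x); nra.
  - have -> : EFin \o (fun x => 1 + `|X x| ^+ 2) =
        (cst 1%E \+ (EFin \o (fun x => (`|X x| ^+ 2)%R)))%E.
      by apply/funext => x /=; rewrite EFinD.
    by apply: integrableD => //; exact: finite_measure_integrable_cst.
have := integral_affine (c ^+ 2) (2 * c) 1 iX iX2 EX EX2.
rewrite mulr0 addr0 mul1r => <-; apply: eq_integral => x _.
by rewrite real_normK ?num_real//; congr EFin; ring.
Qed.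

(** Jensen's inequality, by integrating the tangent at the mean m. *)
Lemma powR_mean_le (X : Omega -> R) (a m : R) : 0 < a ->
  measurable_fun setT X -> (forall x, 0 <= X x) -> 0 <= m ->
  (\int[P]_x (X x)%:E = m%:E)%E ->
  ((m `^ (1 + a))%:E <= \int[P]_x (X x `^ (1 + a))%:E)%E.
Proof.
move=> a0 mX X0 m0 EX.
have mXp : measurable_fun setT (fun x => X x `^ (1 + a)).
  exact: (measurableT_comp (measurable_powR _)).
have iX : P.-integrable setT (EFin \o X).
  by apply: (@integrable_ge0 _ m); rewrite ?EX.
set g := (1 + a) * m `^ a.
have g0 : 0 <= g by rewrite mulr_ge0 ?powR_ge0//; lra.
(* With g m added to both sides all integrands are nonnegative, so the moment on the right may be
   infinite. *)
rewrite -(@leeD2rE _ (g * m)%:E)// -EFinD.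
have := integral_affine (m `^ (1 + a)) g 0 iX iX EX EX; rewrite mul0r addr0 => <-.
have -> : (\int[P]_x (X x `^ (1 + a))%:E + (g * m)%:E =
           \int[P]_x (X x `^ (1 + a) + g * m)%:E)%E.
  under [RHS]eq_integral do rewrite EFinD.
  rewrite ge0_integralD//.
  - by rewrite integral_prob_cst.
  - by move=> x _; rewrite lee_fin powR_ge0.
  - exact/measurable_EFinP.
  - by move=> x _; rewrite lee_fin mulr_ge0.
apply: ge0_le_integral => //.
- by move=> x _; rewrite lee_fin mul0r addr0 addr_ge0 ?powR_ge0// mulr_ge0.
- apply/measurable_EFinP; apply: measurable_funD; last exact: measurable_funM.
  by apply: measurable_funD => //; exact: measurable_funM.
- by apply/measurable_EFinP; exact: measurable_funD.
- move=> x _; rewrite lee_fin mul0r addr0.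
  have := powR_ge_tangent a0 m0 (X0 x); rewrite -/g mulrBr; lra.
Qed.

(** Jensen again, with the tangent taken at r = M^(1/(1 + a)), where r^(1 + a) = M: it bounds X by r
    + (X^(1 + a) - M) / g, whose mean is at most r. *)
Lemma mean_le_powR (X : Omega -> R) (a M : R) : 0 < a -> 0 < M ->
  measurable_fun setT X -> (forall x, 0 <= X x) ->
  (\int[P]_x (X x `^ (1 + a))%:E <= M%:E)%E ->
  (\int[P]_x (X x)%:E <= (M `^ (1 / (1 + a)))%:E)%E.
Proof.
move=> a0 M0 mX X0 EX.
have p0 : 1 + a != 0 by rewrite gt_eqF//; lra.
have mXp : measurable_fun setT (fun x => X x `^ (1 + a)).
  exact: (measurableT_comp (measurable_powR _)).
have iXp : P.-integrable setT (EFin \o (fun x => X x `^ (1 + a))).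
  by apply: integrable_ge0 EX => // x; exact: powR_ge0.
have EXp : (\int[P]_x (X x `^ (1 + a))%:E)%E \is a fin_num by exact: integrable_fin_num.
have EXp' := esym (fineK EXp).
set r := M `^ (1 / (1 + a)).
have r0 : 0 < r by exact: powR_gt0.
have rM : r `^ (1 + a) = M by rewrite /r -powRrM mul1r mulVf// powRr1// ltW.
set g := (1 + a) * r `^ a.
have g0 : 0 < g by rewrite mulr_gt0 ?powR_gt0//; lra.
have XM : fine (\int[P]_x (X x `^ (1 + a))%:E) <= M by rewrite -lee_fin fineK.
have key x : X x <= (r - M / g) + g^-1 * X x `^ (1 + a) + 0 * X x `^ (1 + a).
  have := powR_ge_tangent a0 (ltW r0) (X0 x); rewrite rM -/g => H.
  rewrite -(ler_pM2l g0).
  have -> : g * (r - M / g + g^-1 * X x `^ (1 + a) + 0 * X x `^ (1 + a)) =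
    g * r - M + X x `^ (1 + a) by field; rewrite gt_eqF.
  by lra.
apply: (@le_trans _ _ (\int[P]_x ((r - M / g) + g^-1 * X x `^ (1 + a) + 0 * X x `^ (1 + a))%:E)%E).
  apply: ge0_le_integral => //.
  - by move=> x _; rewrite lee_fin.
  - exact/measurable_EFinP.
  - apply/measurable_EFinP; apply: measurable_funD; last exact: measurable_funM.
    by apply: measurable_funD => //; exact: measurable_funM.
  - by move=> x _; rewrite lee_fin.
rewrite (integral_affine _ _ _ iXp iXp EXp' EXp') lee_fin mul0r addr0.
have : g^-1 * fine (\int[P]_x (X x `^ (1 + a))%:E) <= M / g.
  by rewrite mulrC ler_pM2r ?invr_gt0.
by lra.
Qed.

Lemma powR_shift_mean_le (X : Omega -> R) (a m C s : R) : 0 < a <= 1 ->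
  measurable_fun setT X -> (forall x, 0 <= X x) -> 0 <= m ->
  (\int[P]_x (X x)%:E = m%:E)%E ->
  (\int[P]_x (X x `^ (1 + a))%:E <= C%:E)%E ->
  (\int[P]_x (`|s + (X x - m)| `^ (1 + a))%:E <= (`|s| `^ (1 + a) + 4 * C)%:E)%E.
Proof.
move=> a01 mX X0 m0 EX EXC; have /andP[a0 _] := a01.
have mXp : measurable_fun setT (fun x => X x `^ (1 + a)).
  exact: (measurableT_comp (measurable_powR _)).
have iXp : P.-integrable setT (EFin \o (fun x => X x `^ (1 + a))).
  by apply: integrable_ge0 EXC => // x; exact: powR_ge0.
have EXp : (\int[P]_x (X x `^ (1 + a))%:E)%E \is a fin_num by exact: integrable_fin_num.
have EXp' := esym (fineK EXp).
have iX : P.-integrable setT (EFin \o X).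
  by apply: (@integrable_ge0 _ m); rewrite ?EX.
set c := fine (\int[P]_x (X x `^ (1 + a))%:E) in EXp'.
have cC : c <= C by rewrite -lee_fin -EXp'.
have mc : m `^ (1 + a) <= c.
  by rewrite -lee_fin -EXp'; exact: powR_mean_le.
set g := (1 + a) * Num.sg s * `|s| `^ a.
have key x : `|s + (X x - m)| `^ (1 + a) <=
    (`|s| `^ (1 + a) - g * m + 2 * m `^ (1 + a)) + g * X x + 2 * X x `^ (1 + a).
  have := powR_normD_upper s (X x - m) a01; rewrite -/g.
  have p0 : 0 <= 1 + a by lra.
  have := powR_normB_le p0 (X0 x) m0; lra.
apply: (@le_trans _ _ (\int[P]_x ((`|s| `^ (1 + a) - g * m + 2 * m `^ (1 + a))
    + g * X x + 2 * X x `^ (1 + a))%:E)%E).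
  apply: ge0_le_integral => //.
  - apply/measurable_EFinP; apply: (measurableT_comp (measurable_powR _)).
    apply: measurableT_comp => //; apply: measurable_funD => //.
    exact: measurable_funB.
  - apply/measurable_EFinP; apply: measurable_funD; last exact: measurable_funM.
    by apply: measurable_funD => //; exact: measurable_funM.
  - by move=> x _; rewrite lee_fin; exact: key.
rewrite (integral_affine _ _ _ iX iXp EX EXp') lee_fin; lra.
Qed.

End Moments.

(** * Lipschitz functions *)

Lemma lipschitzE {R : realType} (phi : R -> R) (L : R) : L.-lipschitz phi ->
  forall x y, `|phi x - phi y| <= L * `|x - y|.
Proof. by move=> phiL x y; exact: (phiL (x, y)). Qed.

Lemma lipschitz_ge0 {R : realType} (phi : R -> R) (L : R) : L.-lipschitz phi -> 0 <= L.
Proof.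
move=> /lipschitzE/(_ 1 0); rewrite subr0 normr1 mulr1; exact: le_trans.
Qed.

Lemma lipschitz_measurable {R : realType} (phi : R -> R) (L : R) :
  L.-lipschitz phi -> measurable_fun setT phi.
Proof.
move=> phiL; have L0 := lipschitz_ge0 phiL.
apply: continuous_measurable_fun => x; apply/cvgrPdist_le => e e0.
(* L may be 0, hence the divisor L + 1. *)
apply/nbhs_normP; exists (e / (L + 1)); first by rewrite /= divr_gt0//; lra.
move=> y /=; rewrite ltr_pdivlMr; last by lra.
move=> xy; apply: le_trans (lipschitzE phiL x y) _.
have := normr_ge0 (x - y); nra.
Qed.

(** * Moments of the centered sums *)

Section MainBound.
Context {d : measure_display} {Omega : measurableType d} {R : realType}.
Variables (P : probability Omega R) (Z K : nat -> Omega -> R).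
Hypotheses (iidZ : iid P Z) (iidK : iid P K) (ZK : indep_seqs P Z K).
Variables (sigma2 k2 alpha zlo zhi : R).
Hypothesis EZ2 : (\int[P]_x (`|Z 0%N x| ^+ 2)%:E)%E = sigma2%:E.
Hypothesis sigma20 : 0 < sigma2.
Hypothesis EK : (\int[P]_x (K 0%N x)%:E)%E = 0%E.
Hypothesis EK2 : (\int[P]_x (`|K 0%N x| ^+ 2)%:E)%E = k2%:E.
Hypothesis k20 : 0 < k2.
Hypothesis alpha01 : 0 < alpha <= 1.
Hypothesis zlo0 : 0 < zlo.
Hypothesis zlohi : zlo < zhi.

Let Sigma := Sigma_tilde Z K zlo zhi.

(** For a control value z, [sq_step] is X^z as a function of the pair and [sq_mean] is m(z);
    [centered_sum] is S_n. *)
Definition sq_step (z : R) (w : R * R) : R := (z * w.1 + w.2) ^+ 2.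
Definition sq_mean (z : R) : R := sigma2 * z ^+ 2 + k2.
Definition centered_sum (zeta : nat -> Omega -> R) (n : nat) (x : Omega) : R :=
  \sum_(i < n) (sq_step (zeta i x) (Z i x, K i x) - sq_mean (zeta i x)).

Lemma measurableZ i : measurable_fun setT (Z i). Proof. by case: iidZ. Qed.
Lemma measurableK i : measurable_fun setT (K i). Proof. by case: iidK. Qed.

Lemma measurable_sq_step (z : R) :
  measurable_fun setT (fun x => sq_step z (Z 0%N x, K 0%N x)).
Proof.
apply: measurable_funX; apply: measurable_funD; last exact: measurableK.
by apply: measurable_funM => //; exact: measurableZ.
Qed.

(** With Z frozen, the square is that of K shifted by z Z and has mean (z Z)^2 + k2, since K is
    centered; then Z is integrated. *)
Lemma integral_sq_step (z : R) :
  (\int[P]_x (sq_step z (Z 0%N x, K 0%N x))%:E = (sq_mean z)%:E)%E.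
Proof.
rewrite (@ge0_integral_ZK _ _ _ _ _ _ iidZ iidK ZK (fun w => (sq_step z w)%:E)).
- under eq_integral => x _ do
    rewrite (integral_sqr_shift (z * Z 0%N x) (measurableK 0) EK EK2).
  have iZ2 : P.-integrable setT (EFin \o (fun x => `|Z 0%N x| ^+ 2)).
    apply: (@integrable_ge0 _ _ _ _ _ sigma2); rewrite ?EZ2//.
    by apply: measurable_funX; apply: measurableT_comp => //; exact: measurableZ.
  have := integral_affine k2 (z ^+ 2) 0 iZ2 iZ2 EZ2 EZ2.
  rewrite mul0r addr0 /sq_mean addrC mulrC => <-; apply: eq_integral => x _.
  by rewrite real_normK ?num_real//; congr EFin; ring.
- apply/measurable_EFinP; apply: measurable_funX; apply: measurable_funD => //.
  by apply: measurable_funM.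
- by move=> w; rewrite lee_fin sqr_ge0.
Qed.

Lemma filtr_const (c : R) j : measurable_wrt (filtr Z K j) (fun=> c).
Proof. by apply/measurable_wrt_fun. Qed.

Lemma Sigma_const z : zlo <= z <= zhi -> Sigma (fun _ _ => z).
Proof. by move=> zz; split => // j; exact: filtr_const. Qed.

Lemma sq_step_wrt zeta i n : Sigma zeta -> (i < n)%N ->
  measurable_wrt (filtr Z K n)
    (fun x => sq_step (zeta i x) (Z i x, K i x) - sq_mean (zeta i x)).
Proof.
move=> [mzeta _] ni.
have mX X : (X = Z \/ X = K) -> measurable_wrt (filtr Z K n) (X i).
  move=> XZK B mB; apply: sub_sigma_algebra; exists i => //.
  by case: XZK => ->; [left|right]; exists B.
have := mX Z (or_introl erefl) => /measurable_wrt_fun mZ.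
have := mX K (or_intror erefl) => /measurable_wrt_fun mK.
have : measurable_wrt (filtr Z K n) (zeta i).
  by move=> B mB; apply: (filtr_mono (ltnW ni)); exact: mzeta.
move=> /measurable_wrt_fun mz.
apply/measurable_wrt_fun; apply: measurable_funB.
  apply: measurable_funX; apply: measurable_funD => //.
  exact: measurable_funM.
apply: measurable_funD => //; apply: measurable_funM => //.
exact: measurable_funX.
Qed.

Lemma centered_sum_wrt zeta n : Sigma zeta ->
  measurable_wrt (filtr Z K n) (centered_sum zeta n).
Proof.
move=> Szeta; apply/measurable_wrt_fun; apply: measurable_sum => i.
by apply/measurable_wrt_fun; exact: sq_step_wrt.
Qed.

Lemma wrt_measurable n (X : Omega -> R) : measurable_wrt (filtr Z K n) X -> measurable_fun setT X.
Proof.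
by move=> mX _ B mB; rewrite setTI; apply: (filtr_measurable iidZ iidK (mX _ mB)).
Qed.

Section FixedC.
Variable C : R.
(** Stated for constant controls, because the induction below meets zeta with its value frozen. *)
Hypothesis moment_le : forall z, zlo <= z <= zhi ->
  (\int[P]_x (sq_step z (Z 0%N x, K 0%N x) `^ (1 + alpha))%:E <= C%:E)%E.

(** Jensen at the constant control [zlo], whose mean m(zlo) is positive. *)
Lemma moment_gt0 : 0 < C.
Proof.
have /andP[a0 _] := alpha01.
have zz : zlo <= zlo <= zhi by rewrite lexx ltW.
have m0 : 0 < sq_mean zlo by rewrite addr_gt0// mulr_gt0// exprn_gt0.
have := @powR_mean_le _ _ _ P _ alpha (sq_mean zlo) a0 (measurable_sq_step zlo)
  (fun x => sqr_ge0 _) (ltW m0) (integral_sq_step zlo).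
move=> /le_trans /(_ (moment_le zz)); rewrite lee_fin; apply: lt_le_trans.
exact: powR_gt0.
Qed.

(** Induction on n: each new term adds at most 4 C. *)
Lemma centered_sum_moment zeta n : Sigma zeta ->
  (\int[P]_x (`|centered_sum zeta n x| `^ (1 + alpha))%:E <= (4 * C * n%:R)%:E)%E.
Proof.
move=> Szeta; have /andP[a0 _] := alpha01; have [mzeta zetaE] := Szeta.
elim: n => [|n IHn].
  under eq_integral => x _ do
    rewrite /centered_sum big_ord0 normr0 powR0 ?gt_eqF ?addr_gt0//.
  by rewrite integral0 mulr0.
(* The first component of [v] holds the past sum and the control, the second the fresh pair. *)
pose f (v : (R * R) * (R * R)) : \bar R :=
  (`|v.1.1 + (sq_step v.1.2 v.2 - sq_mean v.1.2)| `^ (1 + alpha))%:E.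
have mf : measurable_fun [set: (R * R) * (R * R)] f.
  have m1 : measurable_fun [set: (R * R) * (R * R)] (fun v => v.1.1).
    exact: (measurableT_comp measurable_fst measurable_fst).
  have m2 : measurable_fun [set: (R * R) * (R * R)] (fun v => v.1.2).
    exact: (measurableT_comp measurable_snd measurable_fst).
  have m3 : measurable_fun [set: (R * R) * (R * R)] (fun v => v.2.1).
    exact: (measurableT_comp measurable_fst measurable_snd).
  have m4 : measurable_fun [set: (R * R) * (R * R)] (fun v => v.2.2).
    exact: (measurableT_comp measurable_snd measurable_snd).
  apply/measurable_EFinP; apply: (measurableT_comp (measurable_powR _)).
  apply: measurableT_comp => //; apply: measurable_funD => //.
  apply: measurable_funB.
    by apply: measurable_funX; apply: measurable_funD => //; exact: measurable_funM.
  apply: measurable_funD => //; apply: measurable_funM => //.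
  exact: measurable_funX.
pose X x := (centered_sum zeta n x, zeta n x).
(* [X] is known before the pair at time [n]: the sum by adaptedness, the control by
   predictability. *)
have mX A : measurable A -> filtr Z K n (X @^-1` A).
  move=> mA.
  pose G : set (set Omega) :=
    \bigcup_(i in [set i | (i < n)%N]) (preimages (Z i) `|` preimages (K i)).
  have : measurable_fun setT (X : g_sigma_algebraType G -> (R * R)%type).
    apply: measurable_fun_pair; apply/measurable_wrt_fun.
      exact: (@centered_sum_wrt zeta n Szeta).
    exact: mzeta.
  by move=> /(_ measurableT A mA); rewrite setTI.
have mS := wrt_measurable (@centered_sum_wrt zeta n Szeta).
have mSp : measurable_fun setT
    (fun x => (`|centered_sum zeta n x| `^ (1 + alpha))%:E).
  apply/measurable_EFinP; apply: (measurableT_comp (measurable_powR _)).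
  exact: measurableT_comp.
have -> : (\int[P]_x (`|centered_sum zeta n.+1 x| `^ (1 + alpha))%:E =
           \int[P]_x f (X x, (Z n x, K n x)))%E.
  by apply: eq_integral => x _; rewrite /centered_sum big_ord_recr.
rewrite (ge0_integral_filtr iidZ iidK ZK mX mf); last first.
  by move=> v; rewrite lee_fin powR_ge0.
apply: (@le_trans _ _
  (\int[P]_x ((`|centered_sum zeta n x| `^ (1 + alpha))%:E + (4 * C)%:E))%E).
  apply: ge0_le_integral => //.
  - by move=> x _; apply: integral_ge0 => y _; rewrite lee_fin powR_ge0.
  - have mXO : measurable_fun setT X.
      by move=> _ A mA; rewrite setTI; apply: (filtr_measurable iidZ iidK (mX _ mA)).
    (* Tonelli on Omega x Omega gives measurability of the inner integral in x. *)
    apply: (@measurable_fun_fubini_tonelli_F _ _ _ _ _ P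
      (fun w : Omega * Omega => f (X w.1, (Z 0%N w.2, K 0%N w.2)))).
      apply: (measurableT_comp mf); apply: measurable_fun_pair.
        exact: (measurableT_comp mXO measurable_fst).
      apply: measurable_fun_pair.
        exact: (measurableT_comp (measurableZ 0) measurable_snd).
      exact: (measurableT_comp (measurableK 0) measurable_snd).
    by move=> w; rewrite lee_fin powR_ge0.
  - exact: emeasurable_funD.
  - move=> x _; rewrite -EFinD.
    have m0 : 0 <= sq_mean (zeta n x).
      by rewrite addr_ge0 ?(ltW k20)// mulr_ge0 ?sqr_ge0 ?(ltW sigma20).
    exact: (@powR_shift_mean_le _ _ _ P
      (fun y => sq_step (zeta n x) (Z 0%N y, K 0%N y)) alpha (sq_mean (zeta n x))
      C (centered_sum zeta n x) alpha01 (measurable_sq_step _)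
      (fun y => sqr_ge0 _) m0 (integral_sq_step _) (moment_le (zetaE n x))).
rewrite ge0_integralD//.
- rewrite integral_prob_cst -[n.+1%:R]natr1 mulrDr mulr1 EFinD.
  by rewrite leeD2r.
- by move=> x _; rewrite lee_fin mulr_ge0// ltW// moment_gt0.
Qed.

(** The error bound of the theorem without its Lipschitz factor; it will control E|S_n| / n. *)
Let rate n := (4 * C / n%:R `^ alpha) `^ (1 / (1 + alpha)).

Lemma measurable_centered_sum zeta n : Sigma zeta ->
  measurable_fun setT (fun x => `|centered_sum zeta n x|).
Proof.
move=> Szeta; apply: measurableT_comp => //.
exact: wrt_measurable (@centered_sum_wrt zeta n Szeta).
Qed.

Lemma centered_sum_mean zeta n : Sigma zeta -> (0 < n)%N ->
  (\int[P]_x (`|centered_sum zeta n x|)%:E <= (rate n * n%:R)%:E)%E.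
Proof.
move=> Szeta n0; have /andP[a0 _] := alpha01.
have n0' : 0 < n%:R :> R by rewrite ltr0n.
have M0 : 0 < 4 * C * n%:R by rewrite !mulr_gt0// moment_gt0.
have -> : rate n * n%:R = (4 * C * n%:R) `^ (1 / (1 + alpha)).
  (* In this form the root of order 1 + alpha turns the last factor into n. *)
  have -> : 4 * C * n%:R = 4 * C / n%:R `^ alpha * n%:R `^ (1 + alpha).
    by rewrite powRD1 1?ltW//; field; rewrite gt_eqF// powR_gt0.
  rewrite [RHS]powRM ?powR_ge0// ?divr_ge0 ?powR_ge0 ?mulr_ge0 ?(ltW moment_gt0)//.
  have p0 : 1 + alpha != 0 by rewrite gt_eqF//; lra.
  have -> : (n%:R `^ (1 + alpha)) `^ (1 / (1 + alpha)) = n%:R :> R.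
    by rewrite -powRrM mul1r mulfV// powRr1.
  by [].
apply: mean_le_powR => //; first exact: measurable_centered_sum.
exact: centered_sum_moment.
Qed.

(** * Comparison of W with the averaged means *)

Definition mean_avg (zeta : nat -> Omega -> R) (n : nat) (x : Omega) : R :=
  (\sum_(i < n) sq_mean (zeta i x)) / n%:R.

Lemma W_centered zeta n x :
  W Z K zeta n x = centered_sum zeta n x / n%:R + mean_avg zeta n x.
Proof. by rewrite -mulrDl -big_split/=; congr (_ / _); apply: eq_bigr => i _; rewrite subrK. Qed.

(** m is increasing on the nonnegative reals, so each term lies between m(zlo) and m(zhi). *)
Lemma mean_avg_itv zeta n x : Sigma zeta -> (0 < n)%N ->
  sq_mean zlo <= mean_avg zeta n x <= sq_mean zhi.
Proof.
move=> [_ zetaE] n0.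
have n0' : 0 < n%:R :> R by rewrite ltr0n.
have sumc (c : R) : c * n%:R = \sum_(i < n) c by rewrite sumr_const card_ord mulr_natr.
rewrite ler_pdivlMr// ler_pdivrMr// !sumc.
have mono u v : 0 <= u -> u <= v -> sq_mean u <= sq_mean v.
  by move=> u0 uv; rewrite lerD2r ler_pM2l// ler_sqr ?nnegrE// (le_trans u0).
apply/andP; split; apply: ler_sum => i _; have /andP[lo hi] := zetaE i x.
  by apply: mono => //; exact: ltW.
by apply: mono => //; apply: le_trans lo; exact: ltW.
Qed.

Section FixedPhi.
Variables (phi : R -> R) (L : R).
Hypothesis phiL : L.-lipschitz phi.

Lemma phi_W_near zeta n x : (0 < n)%N ->
  `|phi (W Z K zeta n x) - phi (mean_avg zeta n x)| <=
  L / n%:R * `|centered_sum zeta n x|.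
Proof.
move=> n0; apply: le_trans (lipschitzE phiL _ _) _.
rewrite W_centered addrK normrM normfV normr_nat.
by rewrite mulrA mulrAC.
Qed.

Lemma measurable_W zeta n : Sigma zeta -> measurable_fun setT (W Z K zeta n).
Proof.
move=> [mzeta _]; apply: measurable_funM => //; apply: measurable_sum => i.
apply: measurable_funX; apply: measurable_funD; last exact: measurableK.
apply: measurable_funM; last exact: measurableZ.
exact: wrt_measurable (mzeta i).
Qed.

Lemma integrable_centered_sum zeta n : Sigma zeta -> (0 < n)%N ->
  P.-integrable setT (EFin \o (fun x => `|centered_sum zeta n x|)).
Proof.
move=> Szeta n0; apply: integrable_ge0 (centered_sum_mean Szeta n0) => //.
exact: measurable_centered_sum.
Qed.

(** Dominated by a constant plus L |S_n| / n; the constant bounds |phi| on the interval of means,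
    starting from its left end. *)
Lemma integrable_phi_W zeta n : Sigma zeta -> (0 < n)%N ->
  P.-integrable setT (EFin \o (fun x => phi (W Z K zeta n x))).
Proof.
move=> Szeta n0; have iS := integrable_centered_sum Szeta n0.
have L0 := lipschitz_ge0 phiL.
set A := `|phi (sq_mean zlo)| + L * (sq_mean zhi - sq_mean zlo).
apply: le_integrable (integrable_affine A (L / n%:R) 0 iS iS) => //.
  apply/measurable_EFinP.
  exact: (measurableT_comp (lipschitz_measurable phiL) (measurable_W n Szeta)).
move=> x _ /=; rewrite lee_fin mul0r addr0; apply: le_trans (ler_norm _).
have H1 := phi_W_near zeta x n0.
have /andP[lo hi] := mean_avg_itv x Szeta n0.
have H2 : `|phi (mean_avg zeta n x) - phi (sq_mean zlo)| <=
    L * (sq_mean zhi - sq_mean zlo).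
  apply: le_trans (lipschitzE phiL _ _) _.
  by rewrite ler_wpM2l// ger0_norm ?subr_ge0// lerD2r.
have := ler_normD (phi (W Z K zeta n x) - phi (mean_avg zeta n x))
  (phi (mean_avg zeta n x) - phi (sq_mean zlo) + phi (sq_mean zlo)).
have := ler_normD (phi (mean_avg zeta n x) - phi (sq_mean zlo)) (phi (sq_mean zlo)).
rewrite subrK subrK /A; lra.
Qed.

(** Here e is E|S_n| / n. An equality serves both b = L for the upper bound and b = -L for the lower
    one. *)
Lemma integral_affine_centered_sum zeta n (c b : R) : Sigma zeta -> (0 < n)%N ->
  exists2 e, 0 <= e <= rate n &
  (\int[P]_x (c + b / n%:R * `|centered_sum zeta n x| + 0 * `|centered_sum zeta n x|)%:E
    = (c + b * e)%:E)%E.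
Proof.
move=> Szeta n0; have iS := integrable_centered_sum Szeta n0.
have n0' : 0 < n%:R :> R by rewrite ltr0n.
have ES : (\int[P]_x (`|centered_sum zeta n x|)%:E)%E \is a fin_num.
  exact: integrable_fin_num.
have ES' := esym (fineK ES).
have := centered_sum_mean Szeta n0; rewrite ES' lee_fin => Sle.
exists (fine (\int[P]_x (`|centered_sum zeta n x|)%:E) / n%:R).
  rewrite ler_pdivrMr// Sle divr_ge0 ?ler0n// fine_ge0//.
  by apply: integral_ge0 => x _; rewrite lee_fin.
rewrite (integral_affine _ _ _ iS iS ES' ES') mul0r addr0.
by congr (_ + _)%:E; rewrite mulrAC mulrA.
Qed.

Lemma integral_phi_W_le zeta n c : Sigma zeta -> (0 < n)%N ->
  (forall x, phi (mean_avg zeta n x) <= c) ->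
  (\int[P]_x (phi (W Z K zeta n x))%:E <= (c + L * rate n)%:E)%E.
Proof.
move=> Szeta n0 phic; have iS := integrable_centered_sum Szeta n0.
have [e /andP[_ er] E] := integral_affine_centered_sum c L Szeta n0.
apply: (@le_trans _ _ (c + L * e)%:E); last first.
  by rewrite lee_fin lerD2l ler_wpM2l// (lipschitz_ge0 phiL).
rewrite -E; apply: le_integral => //.
- exact: integrable_phi_W.
- exact: integrable_affine.
- move=> x _; rewrite lee_fin mul0r addr0.
  have := phi_W_near zeta x n0; rewrite ler_norml => /andP[_].
  have := phic x; lra.
Qed.

Lemma integral_phi_W_ge zeta n c : Sigma zeta -> (0 < n)%N ->
  (forall x, c <= phi (mean_avg zeta n x)) ->
  ((c - L * rate n)%:E <= \int[P]_x (phi (W Z K zeta n x))%:E)%E.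
Proof.
move=> Szeta n0 phic; have iS := integrable_centered_sum Szeta n0.
have [e /andP[_ er] E] := integral_affine_centered_sum c (- L) Szeta n0.
apply: (@le_trans _ _ (c + - L * e)%:E).
  by rewrite lee_fin lerD2l mulNr lerN2 ler_wpM2l// (lipschitz_ge0 phiL).
rewrite -E; apply: le_integral => //.
- exact: integrable_affine.
- exact: integrable_phi_W.
- move=> x _; rewrite lee_fin mul0r addr0.
  have := phi_W_near zeta x n0; rewrite ler_norml => /andP[+ _].
  have := phic x; lra.
Qed.

(** Every control keeps the averaged means in the interval, which gives the upper bound; a constant
    control holds them at any chosen point, which gives the lower one. *)
Lemma sup_phi_W_near n : (0 < n)%N ->
  (`| ereal_sup [set (\int[P]_x (phi (W Z K zeta n x))%:E)%E | zeta in Sigma]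
      - (sup [set phi r | r in `[sq_mean zlo, sq_mean zhi]])%:E |
   <= (L * rate n)%:E)%E.
Proof.
move=> n0; have L0 := lipschitz_ge0 phiL.
set A := [set phi r | r in _]; set s := ereal_sup _.
have mlohi : sq_mean zlo <= sq_mean zhi.
  (* An averaged mean at some sample point lies between the two ends, which are thus in order. *)
  have x : Omega := point.
  have zz : zlo <= zlo <= zhi by rewrite lexx ltW.
  by have /andP[/le_trans] := mean_avg_itv x (Sigma_const zz) n0; apply.
(* [sup] on the reals is a true supremum only for a nonempty set bounded above. *)
have A0 : A !=set0.
  by exists (phi (sq_mean zlo)), (sq_mean zlo) => //=; rewrite in_itv/= lexx.
have ubA : has_ubound A.
  exists (phi (sq_mean zlo) + L * (sq_mean zhi - sq_mean zlo)) => _ [r /= + <-].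
  rewrite in_itv/= => /andP[lor rhi].
  have := le_trans (ler_norm _) (lipschitzE phiL r (sq_mean zlo)).
  rewrite [`|_|]ger0_norm ?subr_ge0//.
  have : L * (r - sq_mean zlo) <= L * (sq_mean zhi - sq_mean zlo).
    by rewrite ler_wpM2l// lerD2r.
  by lra.
have sle : (s <= (sup A + L * rate n)%:E)%E.
  apply: ge_ereal_sup => _ [zeta Szeta <-]; apply: integral_phi_W_le => // x.
  apply: ub_le_sup => //; exists (mean_avg zeta n x) => //=.
  by rewrite in_itv/=; exact: mean_avg_itv.
have sge r : A r -> ((r - L * rate n)%:E <= s)%E.
  move=> [m /= + <-]; rewrite in_itv/= => /andP[lom mhi].
  (* Solves m(z) = m for the prescribed point; since m(.) is increasing, z then lies in
     [zlo, zhi]. *)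
  set z := Num.sqrt ((m - k2) / sigma2).
  have zE : sq_mean z = m.
    rewrite /sq_mean sqr_sqrtr; first by field; rewrite gt_eqF.
    rewrite divr_ge0 ?(ltW sigma20)// subr_ge0; apply: le_trans lom.
    by rewrite lerDr mulr_ge0 ?sqr_ge0// ltW.
  have sqr_sq_mean u v : 0 <= u -> 0 <= v -> sq_mean u <= sq_mean v -> u <= v.
    by move=> u0 v0; rewrite lerD2r ler_pM2l// ler_sqr.
  have zz : zlo <= z <= zhi.
    by apply/andP; split; apply: sqr_sq_mean; rewrite ?sqrtr_ge0 ?zE// ltW// (lt_trans zlo0).
  apply: ereal_sup_ge; exists (\int[P]_x (phi (W Z K (fun _ _ => z) n x))%:E)%E.
    by exists (fun _ _ => z) => //; exact: Sigma_const.
  apply: integral_phi_W_ge => //; first exact: Sigma_const.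
  move=> x; rewrite /mean_avg sumr_const card_ord zE -[m *+ n]mulr_natr mulfK//.
  by rewrite pnatr_eq0 -lt0n.
have [r0 Ar0] := A0.
(* The two bounds exclude both infinities, and the rest is an inequality between reals. *)
have sfin : s \is a fin_num.
  by rewrite fin_numE; apply/andP; split; apply/eqP => sE; move: sle (sge _ Ar0); rewrite sE.
move: sle sge; rewrite -(fineK sfin) => sle sge.
rewrite -EFinB abse_EFin lee_fin ler_norml; apply/andP; split; last first.
  by move: sle; rewrite lee_fin; lra.
have : sup A <= fine s + L * rate n.
  by apply: ge_sup => // r /sge; rewrite lee_fin; lra.
by lra.
Qed.

End FixedPhi.
End FixedC.
End MainBound.

(** * The bound on C and the conclusion *)

(** Pointwise the integrand is |zeta Z + K|^q with q = 2 + 2 alpha in (2, 4], to which the bound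
    with factor 8 applies; then zeta <= zhi. *)
Lemma integral_sq_step_powR_le {d : measure_display} {Omega : measurableType d}
  {R : realType} (P : probability Omega R) (Z K zeta : Omega -> R) (alpha zhi : R) :
  measurable_fun setT Z -> measurable_fun setT K ->
  measurable_fun setT zeta -> 0 < alpha <= 1 -> 0 <= zhi ->
  (forall x, 0 <= zeta x <= zhi) ->
  (\int[P]_x (`|(zeta x * Z x + K x) ^+ 2| `^ (1 + alpha))%:E <=
   8%:E * (zhi `^ (2 + 2 * alpha))%:E * \int[P]_x (`|Z x| `^ (2 + 2 * alpha))%:E
   + 8%:E * \int[P]_x (`|K x| `^ (2 + 2 * alpha))%:E)%E.
Proof.
move=> mZ mK mzeta alpha01 zhi0 zetaE; set q := 2 + 2 * alpha.
have q14 : 1 < q <= 4 by rewrite /q; lra.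
have mq (X : Omega -> R) : measurable_fun setT X ->
    measurable_fun setT (fun x => (`|X x| `^ q)%:E).
  move=> mX; apply/measurable_EFinP; apply: (measurableT_comp (measurable_powR _)).
  exact: measurableT_comp.
have q0 (X : Omega -> R) x : (0 <= (`|X x| `^ q)%:E)%E by rewrite lee_fin powR_ge0.
have k0 : 0 <= 8 * zhi `^ q by rewrite mulr_ge0 ?powR_ge0.
have mkZ : measurable_fun setT (fun x => (8 * zhi `^ q)%:E * (`|Z x| `^ q)%:E)%E.
  by apply: emeasurable_funM => //; exact: mq.
have mkK : measurable_fun setT (fun x => 8%:E * (`|K x| `^ q)%:E)%E.
  by apply: emeasurable_funM => //; exact: mq.
rewrite -EFinM -!ge0_integralZl_EFin//; [|exact: mq..].
rewrite -ge0_integralD//; last by move=> x _; rewrite mule_ge0.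
apply: ge0_le_integral => //.
- apply/measurable_EFinP; apply: (measurableT_comp (measurable_powR _)).
  apply: measurableT_comp => //; apply: measurable_funX.
  by apply: measurable_funD => //; exact: measurable_funM.
- exact: emeasurable_funD.
- move=> x _; rewrite -!EFinM -EFinD lee_fin.
  have -> : `|(zeta x * Z x + K x) ^+ 2| `^ (1 + alpha) = `|zeta x * Z x + K x| `^ q.
    by rewrite normrX -powR_mulrn// -powRrM; congr (_ `^ _); rewrite /q; ring.
  apply: le_trans (powR_normD_le8 _ _ q14) _.
  rewrite mulrDr lerD2r -mulrA ler_wpM2l// normrM powRM//.
  have /andP[z0 zh] := zetaE x; rewrite ler_wpM2r ?powR_ge0// ger0_norm//.
  by apply: ge0_ler_powR; rewrite ?nnegrE//; lra.
Qed.

Unset Implicit Arguments.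

Theorem theorem3p1 (d : measure_display) (Omega : measurableType d)
  (R : realType) (P : probability Omega R) (Z K : nat -> Omega -> R)
  (sigma2 k2 alpha zlo zhi : R) :
  iid P Z -> iid P K -> indep_seqs P Z K ->
  (\int[P]_x (`|Z 0%N x| ^+ 2)%:E)%E = sigma2%:E -> 0 < sigma2 ->
  (\int[P]_x (K 0%N x)%:E)%E = 0%E ->
  (\int[P]_x (`|K 0%N x| ^+ 2)%:E)%E = k2%:E -> 0 < k2 ->
  0 < alpha <= 1 ->
  (\int[P]_x (`|Z 0%N x| `^ (2 + 2 * alpha))%:E < +oo)%E ->
  (\int[P]_x (`|K 0%N x| `^ (2 + 2 * alpha))%:E < +oo)%E ->
  0 < zlo -> zlo < zhi ->
  exists C : R,
    ereal_sup [set (\int[P]_x (`|(zeta 0%N x * Z 0%N x + K 0%N x) ^+ 2|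
                                   `^ (1 + alpha))%:E)%E
              | zeta in Sigma_tilde Z K zlo zhi] = C%:E /\
    (C%:E <= 8%:E * (zhi `^ (2 + 2 * alpha))%:E
                  * \int[P]_x (`|Z 0%N x| `^ (2 + 2 * alpha))%:E
             + 8%:E * \int[P]_x (`|K 0%N x| `^ (2 + 2 * alpha))%:E)%E /\
    forall (phi : R -> R) (Lphi : R), Lphi.-lipschitz phi ->
    forall n : nat, (0 < n)%N ->
      (`| ereal_sup [set (\int[P]_x (phi (W Z K zeta n x))%:E)%E
                    | zeta in Sigma_tilde Z K zlo zhi]
          - (sup [set phi r | r in `[sigma2 * zlo ^+ 2 + k2,
                                    sigma2 * zhi ^+ 2 + k2]])%:E |
       <= (Lphi * (4 * C / n%:R `^ alpha) `^ (1 / (1 + alpha)))%:E)%E.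
Proof.
move=> iidZ iidK ZK EZ2 s0 EK EK2 k20 alpha01 EZq EKq zlo0 zlohi.
set q := 2 + 2 * alpha in EZq EKq *.
have [mZ _] := iidZ; have [mK _] := iidK.
set T := [set _ | zeta in _].
set B := (8%:E * (zhi `^ q)%:E * _ + _)%E.
have Bfin : (B < +oo)%E.
  by rewrite lte_add_pinfty// lte_mul_pinfty//; rewrite -EFinM lee_fin mulr_ge0 ?powR_ge0.
have supB : (ereal_sup T <= B)%E.
  apply: ge_ereal_sup => _ [zeta [mzeta zetaE] <-].
  apply: integral_sq_step_powR_le => //.
  - exact: (wrt_measurable iidZ iidK (mzeta 0%N)).
  - by rewrite ltW// (lt_trans zlo0).
  - move=> x; have /andP[lo ->] := zetaE 0%N x.
    by rewrite andbT (le_trans _ lo)// ltW.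
(* This excludes -oo, the supremum of the empty set; the constant control [zlo] provides an
   element. *)
have sup0 : (0 <= ereal_sup T)%E.
  have zz : zlo <= zlo <= zhi by rewrite lexx ltW.
  apply: ereal_sup_ge; eexists; first by exists (fun _ _ => zlo); [exact: Sigma_const|reflexivity].
  by apply: integral_ge0 => x _; rewrite lee_fin powR_ge0.
have supfin : ereal_sup T \is a fin_num.
  by rewrite ge0_fin_numE// (le_lt_trans supB).
exists (fine (ereal_sup T)); rewrite fineK//; split => //; split => //.
move=> phi L phiL n n0.
apply: (sup_phi_W_near iidZ iidK ZK EZ2 s0 EK EK2 k20 alpha01 zlo0 zlohi _ phiL n0).
(* Constant controls belong to the family whose supremum is C, which yields the moment bound for
   them. *)
move=> z zz; rewrite fineK//; apply: ereal_sup_ubound.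
exists (fun _ _ => z); first exact: Sigma_const.
by apply: eq_integral => x _; rewrite ger0_norm ?sqr_ge0.
Qed.
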